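(* Let $K$ be a field, let $\Delta$ be a quasi-forest, and let $t$ be the generator of $R_\Delta$ corresponding to the empty face of $\Delta$. Then $(t)$ is a radical ideal of $R_\Delta$.
   Context: Let $\Delta$ be a simplicial complex on $[n]=\{1,\dots,n\}$ (a family of subsets of $[n]$ closed under taking subsets and containing every $\{i\}$). For $F\subseteq[n]$ put $x_F=\prod_{i\in F}x_i$ (with $x_\emptyset=1$). The toric ring is $R_\Delta=K[x_Ft : F\in\Delta]\subset K[x_1,\ldots,x_n,t]$. $\langle F_1,\ldots,F_i\rangle$ denotes the simplicial complex generated by $F_1,\ldots,F_i$. A facet $F$ of a simplicial complex is called a leaf if there exists a facet $G\ne F$ such that $F\cap H\subseteq G$ for every facet $H\neq F$ (if $F$ is the only facet it is also regarded as a leaf). $\Delta$ is a quasi-forest if its facets can be ordered $F_1<\cdots<F_m$ so that $F_i$ is a leaf of $\langle F_1,\ldots,F_i\rangle$ for all $1\le i\le m$. (Equivalently, $\Delta$ is the clique complex of a chordal graph.) *)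

(* Defs.v *)
From HB Require Import structures.
From mathcomp Require Import all_boot all_algebra.
From mathcomp Require Import boolp.
From mathcomp Require Import mpoly.

Set Implicit Arguments.
Unset Strict Implicit.
Unset Printing Implicit Defensive.

Import GRing.Theory.
Local Open Scope ring_scope.

Section Complexes.
Variable n : nat.
Local Notation family := {set {set 'I_n}}.

(* [sc_set0] follows from the other two axioms unless n = 0, where it rules    *)
(* out the empty family.                                                      *)
Record simplicial_complex := SimplicialComplex {
  faces :> family;
  sc_set0 : set0 \in faces;
  sc_sub : forall F G : {set 'I_n}, F \in faces -> G \subset F -> G \in faces;
  sc_vertex : forall i : 'I_n, [set i] \in faces
}.

Implicit Types (D : family) (F G H : {set 'I_n}) (s : seq {set 'I_n}).

Definition facet D F : bool := maxset (mem D) F.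

Definition generated_complex s : family :=
  [set G : {set 'I_n} | has (fun F => G \subset F) s].

Definition leaf D F : Prop :=
  facet D F /\
  ((exists G, [/\ facet D G, G != F
                & forall H, facet D H -> H != F -> F :&: H \subset G])
   \/ (forall H, facet D H -> H = F)).

Definition quasi_forest (D : simplicial_complex) : Prop :=
  exists s, [/\ uniq s, (forall F, (F \in s) = facet D F)
    & forall i, (i < size s)%N ->
        leaf (generated_complex (take i.+1 s)) (nth set0 s i)].

End Complexes.

Section GeneratedSubalgebra.
Variables (K : fieldType) (A : algType K).

(* By [asbool], {pred A} accounts for all subsets of A, so this is the        *)
(* intersection of all K-subalgebras of A containing G.                       *)
Definition subalg_gen (G : {pred A}) : {pred A} :=
  fun a => `[< forall S : {pred A},
                 subalg_closed S -> {subset G <= S} -> a \in S >].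

Lemma subalg_gen_closed G : subalg_closed (subalg_gen G).
Proof.
split; first by apply/asboolP => S [].
- move=> c u v /asboolP Gu /asboolP Gv; apply/asboolP => S SA GS.
  by have [_ Slin _] := SA; apply: Slin; [apply: Gu | apply: Gv].
- move=> u v /asboolP Gu /asboolP Gv; apply/asboolP => S SA GS.
  by have [_ _ Smul] := SA; apply: Smul; [apply: Gu | apply: Gv].
Qed.

Lemma mem_subalg_gen (G : {pred A}) a : a \in G -> a \in subalg_gen G.
Proof. by move=> Ga; apply/asboolP => S _; apply. Qed.

HB.instance Definition _ (G : {pred A}) :=
  GRing.isSubalgClosed.Build K A (subalg_gen G) (subalg_gen_closed G).

End GeneratedSubalgebra.

Section ToricRing.
Variables (K : fieldType) (n : nat).

(* x_F t in K[x_1, ..., x_n, t] = {mpoly K[n.+1]}: the last variable is t.    *)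
Definition face_monomial (F : {set 'I_n}) : {mpoly K[n.+1]} :=
  (\prod_(i in F) 'X_(lift ord_max i)) * 'X_ord_max.

Variable D : {set {set 'I_n}}.

Definition toric_generators : {pred {mpoly K[n.+1]}} :=
  [pred p | [exists F in D, p == face_monomial F]].

Definition toric_ring : Type :=
  {p : {mpoly K[n.+1]} | p \in subalg_gen toric_generators}.

HB.instance Definition _ := SubChoice.on toric_ring.
HB.instance Definition _ :=
  [SubChoice_isSubComNzRing of toric_ring by <:].
HB.instance Definition _ := [SubZmodule_isSubLmodule of toric_ring by <:].
HB.instance Definition _ :=
  [SubNzRing_SubLmodule_isSubLalgebra of toric_ring by <:].

Lemma toric_generatorP (F : {set 'I_n}) :
  F \in D -> face_monomial F \in subalg_gen toric_generators.
Proof.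
by move=> FD; apply/mem_subalg_gen/existsP; exists F; rewrite FD eqxx.
Qed.

Definition toric_gen (F : {set 'I_n}) (FD : F \in D) : toric_ring :=
  Sub (face_monomial F) (toric_generatorP FD).

End ToricRing.

Section Ideals.
Variable R : comNzRingType.

Definition principal_ideal (a : R) : {pred R} :=
  fun r => `[< exists b : R, r = b * a >].

(* Ideals of R are the submodules of the regular module R^o; unlike           *)
(* [idealr_closed], this does not require the ideal to be proper.             *)
Definition radical_ideal (I : {pred R}) : Prop :=
  submod_closed (I : {pred R^o}) /\
  forall (r : R) (m : nat), (0 < m)%N -> r ^+ m \in I -> r \in I.

End Ideals.

(* Main.v *)
From mathcomp Require Import all_boot all_algebra.
From mathcomp Require Import boolp mpoly zify ring.
Require Import Defs.

Set Implicit Arguments.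
Unset Strict Implicit.
Unset Printing Implicit Defensive.

(** The ring R_D is spanned by the monomials x^a t^k such that the vector a is a
    sum of k indicator vectors of faces.  Since the empty face is a face, for
    given a these are the k >= c(a), where c(a) is the least number of faces
    covering each vertex i exactly a_i times, and x^a t^k is a multiple of t in
    R_D exactly when k > c(a).  Thus (t) is a monomial ideal.  A monomial ideal
    is radical as soon as it contains a monomial whenever it contains a power
    of it (monomial_ideal_radical), so the claim reduces to c(k a) = k c(a)
    or, more precisely, to c(k a) >= k c(a).

    For a quasi-forest this holds because c(a) is given by a formula that is
    homogeneous in a: c(a) is the maximum, over the sets W containing no two
    vertices of a common face, of the sum of a_i over W.  This is the weighted
    form of the fact that in a chordal graph the clique cover number equals the
    independence number.  A face meets such a W at most once, so the sum bounds
    from below the size of every cover (leq_sum_multiplicity).  A cover and a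
    set W of the same size are built together (clique_cover_duality) by
    eliminating simplicial vertices, which the leaf order provides in every
    induced subcomplex (quasi_forest_simplicial). *)

(** * Face covers and stable sets *)

Section Covers.
Variables (n : nat) (D : simplicial_complex n).
Implicit Types (F G H U W : {set 'I_n}) (s : seq {set 'I_n}).
Implicit Types (a : 'I_n -> nat) (i j u v w : 'I_n).

Definition multiplicity s i := count (fun F : {set 'I_n} => i \in F) s.

Definition stable W :=
  {in W &, forall v w, v != w -> [set v; w] \notin faces D}.

(** In terms of the graph of D: v is a simplicial vertex of the subcomplex
    induced on U.  The face F witnessing it need not lie in U; this way it can
    be taken to be a facet of D. *)
Definition simplicial_in U v F :=
  [/\ F \in faces D, v \in F
    & forall H, H \in faces D -> v \in H -> H \subset U -> H \subset F].

Definition has_simplicial_vertices :=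
  forall U, U != set0 -> exists2 v, v \in U & exists F, simplicial_in U v F.

Lemma facetP (E : {set {set 'I_n}}) F :
  reflect (F \in E /\ forall G, G \in E -> F \subset G -> G = F) (facet E F).
Proof. exact: maxsetP. Qed.

Lemma generated_facet_mem s G : facet (generated_complex s) G -> G \in s.
Proof.
case/facetP; rewrite inE => /hasP[F Fs GF] maxG.
by rewrite -(maxG F) // inE; apply/hasP; exists F.
Qed.

Lemma facet_generated s F :
  (forall G, G \in s -> facet D G) -> F \in s ->
  facet (generated_complex s) F.
Proof.
move=> facets Fs; apply/facetP; split=> [|G].
  by rewrite inE; apply/hasP; exists F.
rewrite inE => /hasP[H Hs GH] FG.
have /facetP[FD maxF] := facets _ Fs; have /facetP[HD _] := facets _ Hs.
by apply: maxF => //; apply: sc_sub GH.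
Qed.

(** Among the vertices of U choose one, v, whose first facet in the leaf order,
    F_i, comes last; then U lies in the union of F_1, ..., F_i.  A face H of U
    through v lies in some F_k with k >= i.  If k > i, every vertex of H is
    shared by F_k and an earlier facet, so the leaf property puts H in an
    earlier F_l, and by descent H lies in F_i. *)
Lemma quasi_forest_simplicial : quasi_forest D -> has_simplicial_vertices.
Proof.
case=> s [s_uniq sE leaf_s] U /set0Pn[u0 u0U].
have facets k G : G \in take k s -> facet D G by move/mem_take; rewrite sE.
have in_facet H : H \in faces D -> exists2 F, F \in s & H \subset F.
  move=> HD; have [F maxF HF] := maxset_exists (HD : mem (faces D) H).
  by exists F; rewrite ?sE.
pose first v := find (fun F : {set 'I_n} => v \in F) s.
have hasF v : has (fun F : {set 'I_n} => v \in F) s.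
  have [F Fs] := in_facet _ (sc_vertex D v).
  by rewrite sub1set => vF; apply/hasP; exists F.
have first_lt v : first v < size s by rewrite -has_find.
have firstP v : v \in nth set0 s (first v).
  exact: (nth_find set0 (hasF v)).
have first_min v k : v \in nth set0 s k -> first v <= k.
  by move=> vk; rewrite leqNgt; apply/negP => /(before_find set0); rewrite vk.
case: (@arg_maxnP _ u0 (fun v => v \in U) first u0U) => v vU v_max.
exists v => //; exists (nth set0 s (first v)); split=> //.
  have : facet D (nth set0 s (first v)) by rewrite -sE mem_nth.
  by case/facetP.
move=> H HD vH HU; have [F Fs] := in_facet _ HD.
rewrite -(nth_index set0 Fs); have := Fs; rewrite -index_mem.
elim/ltn_ind: (index F s) => k IHk k_lt HFk.
have := first_min v k (subsetP HFk _ vH).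
rewrite leq_eqVlt => /orP[/eqP -> // | lt_vk].
have facet_k l : l <= k ->
    facet (generated_complex (take k.+1 s)) (nth set0 s l).
  move=> le_lk; apply: facet_generated; first exact: facets.
  have lt_lk : l < k.+1 by [].
  rewrite -(nth_take set0 lt_lk) mem_nth // size_take_min leq_min lt_lk.
  exact: leq_ltn_trans k_lt.
have neq_k l : l < k -> nth set0 s l != nth set0 s k.
  move=> lt_lk; rewrite nth_uniq //; first by rewrite ltn_eqF.
  exact: ltn_trans k_lt.
(* F_k cannot be the only facet, since F_i is another one. *)
have [_ [[G [Gfacet GneF Gmeets]] | only]] := leaf_s k k_lt; last first.
  by case/eqP: (neq_k _ lt_vk); apply/only/facet_k/ltnW.
have HG : H \subset G.
  apply/subsetP => w wH; have wU := subsetP HU _ wH.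
  have lt_wk : first w < k by apply: leq_ltn_trans (v_max w wU) lt_vk.
  have /subsetP := Gmeets _ (facet_k _ (ltnW lt_wk)) (neq_k _ lt_wk).
  by apply; rewrite inE (subsetP HFk) ?firstP.
have /(nthP set0)[l] := generated_facet_mem Gfacet.
rewrite size_take_min ltn_min => /andP[lt_lk1 lt_ls].
rewrite nth_take // => Gl; rewrite -Gl in HG GneF.
apply: (IHk l) => //; rewrite ltn_neqAle -ltnS lt_lk1 andbT.
by apply: contraNneq GneF => ->.
Qed.

(** A face contains at most one vertex of a stable set. *)
Lemma leq_sum_multiplicity s W :
  stable W -> {subset s <= faces D} ->
  \sum_(i in W) multiplicity s i <= size s.
Proof.
move=> stW; elim: s => [|F s IHs] sD; first by rewrite big1.
rewrite big_split /= -[(size s).+1]add1n; apply: leq_add; last first.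
  by apply: IHs => G Gs; apply: sD; rewrite inE Gs orbT.
have FD : F \in faces D by apply: sD; rewrite mem_head.
rewrite -big_mkcondr /= sum1_card; apply/card_le1_eqP => i j.
move=> /andP[iW iF] /andP[jW jF]; apply/eqP; apply: contraT => neq_ij.
rewrite -(negbTE (stW j i jW iW neq_ij)); apply: sc_sub FD _.
by rewrite subUset !sub1set jF iF.
Qed.

Lemma multiplicity_cat s1 s2 i :
  multiplicity (s1 ++ s2) i = multiplicity s1 i + multiplicity s2 i.
Proof. exact: count_cat. Qed.

(** The horizontal slices of the function a restricted to F and truncated at
    height c: as a list of subsets of F, they cover each u in F exactly
    min (a u) c times. *)
Definition layers a F c := [seq [set u in F | k < a u] | k <- iota 0 c].

Lemma multiplicity_layers a F c i :
  multiplicity (layers a F c) i = (i \in F) * minn (a i) c.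
Proof.
rewrite /multiplicity /layers count_map.
case iF: (i \in F); last first.
  rewrite mul0n; apply/eqP; rewrite eqn0Ngt -has_count; apply/hasPn => k _.
  by rewrite /= inE iF.
rewrite mul1n (eq_count (a2 := fun k => k < a i)) => [|k]; last first.
  by rewrite /= inE iF.
elim: c => [|c IHc]; first by rewrite minn0.
rewrite -addn1 iotaD count_cat IHc /= add0n addn0.
by case: ltnP; lia.
Qed.

Lemma layers_faces a F c : F \in faces D -> {subset layers a F c <= faces D}.
Proof.
move=> FD _ /mapP[k _ ->]; apply: sc_sub FD _.
by apply/subsetP => u; rewrite inE => /andP[].
Qed.

(** Take a simplicial vertex v of the support of a, with face F, and remove
    a v layers of F; this kills v and leaves a smaller problem a', with cover s'
    and stable set W'.  The cover grows by a v, and so must the weight of the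
    stable set.  If W' meets F, it does so in a single vertex w, whose weight
    rises by exactly a v from a' to a, since a' w > 0.  If not, v can be added
    to W', because all neighbours of v in the support lie in F. *)
Lemma clique_cover_duality a :
  has_simplicial_vertices ->
  exists s W, [/\ {subset s <= faces D}, stable W,
    forall i, multiplicity s i = a i & size s = \sum_(i in W) a i].
Proof.
move=> simplD.
(* Positivity on the stable set is what the induction needs: it keeps W'
   inside the support of a, where v is simplicial. *)
suff [s [W [sD stW sa szs _]]] : exists s W,
    [/\ {subset s <= faces D}, stable W, forall i, multiplicity s i = a i,
        size s = \sum_(i in W) a i & {in W, forall i, 0 < a i}].
  by exists s, W.
have [m] := ubnP #|[set i | 0 < a i]|; elim: m a => // m IHm a.
rewrite ltnS => supp_a.
have [supp0 | ] := eqVneq [set i | 0 < a i] set0.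
  exists [::], set0; split=> //; rewrite ?big_set0 //.
  - by move=> v w; rewrite inE.
  - move=> i; have := in_set0 i; rewrite -supp0 inE /multiplicity /=.
    by case: (a i).
  by move=> i; rewrite inE.
case/simplD => v; rewrite inE => av [F [FD vF Fmax]].
pose a' i := a i - (i \in F) * a v.
have a'v : a' v = 0 by rewrite /a' vF mul1n subnn.
have a'_le i : a' i <= a i by rewrite leq_subr.
have [|s' [W' [s'D stW' s'a szs' supW']]] := IHm a'.
  apply: leq_trans supp_a; apply: proper_card; apply/properP; split.
    by apply/subsetP => i; rewrite !inE => /leq_trans; apply.
  by exists v; rewrite inE ?av // a'v.
have supW'a w : w \in W' -> 0 < a w by move/supW'/leq_trans; apply.
pose s := layers a F (a v) ++ s'.
have sD : {subset s <= faces D}.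
  move=> G; rewrite mem_cat => /orP[]; [exact: layers_faces | exact: s'D].
have sa i : multiplicity s i = a i.
  rewrite multiplicity_cat multiplicity_layers s'a /a'.
  by case: (i \in F); lia.
have szs : size s = a v + \sum_(i in W') a' i.
  by rewrite size_cat size_map size_iota szs'.
have [/existsP[w /andP[wW' wF]] | noF] := boolP [exists w in W', w \in F].
  exists s, W'; split=> //.
  rewrite szs (bigD1 w wW') [RHS](bigD1 w wW') /= addnA; congr addn.
    by have := supW' _ wW'; rewrite /a' wF; lia.
  apply: eq_bigr => i /andP[iW' neq_iw]; rewrite /a'.
  case iF: (i \in F); last by rewrite subn0.
  have := stW' i w iW' wW' neq_iw; rewrite (sc_sub FD) //.
  by rewrite subUset !sub1set iF wF.
have W'F w : w \in W' -> w \notin F.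
  move=> wW'; apply: contraNN noF => wF.
  by apply/existsP; exists w; rewrite wW'.
have vW' : v \notin W' by apply: contraTN vF => /W'F.
have edge_vF w : w \in W' -> [set v; w] \notin faces D.
  move=> wW'; apply: contraNN (W'F w wW') => vwD.
  apply: (subsetP (Fmax _ vwD (set21 v w) _)); last exact: set22.
  by rewrite subUset !sub1set !inE av supW'a.
exists s, (v |: W'); split=> //.
- move=> i j; rewrite !inE => /orP[/eqP -> | iW'] /orP[/eqP -> | jW'].
  + by rewrite eqxx.
  + by move=> _; apply: edge_vF.
  + by move=> _; rewrite setUC; apply: edge_vF.
  exact: stW'.
- rewrite szs big_setU1 //=; congr addn; apply: eq_bigr => i /W'F.
  by rewrite /a' => /negbTE->; rewrite subn0.
by move=> i; rewrite inE => /orP[/set1P -> // | /supW'a].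
Qed.

End Covers.

(** * Monomial ideals in a monomial subalgebra *)

Import GRing.Theory.
Local Open Scope ring_scope.

Section MonomialSupport.
Variables (n : nat) (R : idomainType).
Implicit Types (p q : {mpoly R[n]}) (m : 'X_{1..n}).
Implicit Types (P Q S T : 'X_{1..n} -> Prop).

Definition supported P p := forall m, m \in msupp p -> P m.

Lemma supportedD P p q : supported P p -> supported P q -> supported P (p + q).
Proof. by move=> Pp Pq m /msuppD_le; rewrite mem_cat => /orP[/Pp | /Pq]. Qed.

Lemma supportedZ P c p : supported P p -> supported P (c *: p).
Proof. by move=> Pp m /msuppZ_le/Pp. Qed.

Lemma supportedM P Q T p q :
  (forall m1 m2, P m1 -> Q m2 -> T (m1 + m2)%MM) ->
  supported P p -> supported Q q -> supported T (p * q).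
Proof.
move=> PQT Pp Qq m /msuppM_le/allpairsP[[m1 m2] /= [/Pp Pm1 /Qq Qm2 ->]].
exact: PQT.
Qed.

Lemma supportedN P p : supported P p -> supported P (- p).
Proof. by rewrite -scaleN1r; apply: supportedZ. Qed.

Lemma supported0 P : supported P 0.
Proof. by move=> m; rewrite msupp0. Qed.

Lemma supported1 P : P 0%MM -> supported P 1.
Proof. by move=> P0 m; rewrite -mpolyC1 msupp1 inE => /eqP->. Qed.

Lemma supportedX P m : supported P 'X_[m] <-> P m.
Proof.
split=> [|Pm k]; last by rewrite msuppX inE => /eqP->.
by apply; rewrite msuppX mem_head.
Qed.

Lemma supported_sum P (r : seq 'X_{1..n}) (Q : pred 'X_{1..n}) F :
  (forall m, m \in r -> Q m -> supported P (F m)) ->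
  supported P (\sum_(m <- r | Q m) F m).
Proof.
move=> PF; rewrite big_seq_cond.
elim/big_ind: _ => [||m /andP[mr Qm]]; last exact: PF.
- exact: supported0.
- exact: supportedD.
Qed.

Lemma supported_split P Q p : supported P p ->
  exists g h, [/\ p = g + h, supported (fun m => P m /\ ~ Q m) g
                & supported (fun m => P m /\ Q m) h].
Proof.
move=> Pp; exists (\sum_(m <- msupp p | ~~ `[< Q m >]) p@_m *: 'X_[m]).
exists (\sum_(m <- msupp p | `[< Q m >]) p@_m *: 'X_[m]).
split; first by rewrite {1}[p]mpolyE (bigID (fun m => `[< Q m >])) addrC.
  apply: supported_sum => m /Pp Pm /asboolPn Qm.
  by apply: supportedZ; apply/supportedX.
apply: supported_sum => m /Pp Pm /asboolP Qm.
by apply: supportedZ; apply/supportedX.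
Qed.

(** Modulo the T-part h of p, the power p ^+ k agrees with g ^+ k, where g
    collects the terms of p outside T.  If g were nonzero, the leading monomial
    of g ^+ k, which is k times that of g because the coefficients form a
    domain, would lie in T, hence so would that of g. *)
Lemma monomial_ideal_radical S T p k :
  S 0%MM -> (forall m1 m2, S m1 -> S m2 -> S (m1 + m2)%MM) ->
  (forall m1 m2, S m1 -> T m2 -> T (m1 + m2)%MM) ->
  (forall m j, T (m *+ j)%MM -> T m) ->
  supported S p -> supported T (p ^+ k) -> supported T p.
Proof.
move=> S0 SD TD Trad Sp Tpk.
have [g [h [def_p Sg Th']]] := supported_split T Sp.
have Sg' : supported S g by move=> m /Sg[].
have Th : supported T h by move=> m /Th'[].
have Tdiff j : supported T (p ^+ j - g ^+ j).
  elim: j => [|j IHj]; first by rewrite !expr0 subrr; apply: supported0.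
  have -> : p ^+ j.+1 - g ^+ j.+1 = p * (p ^+ j - g ^+ j) + g ^+ j * h.
    by rewrite [h](_ : h = p - g) ?exprS; [ring | rewrite def_p addrC addKr].
  apply: supportedD; first exact: supportedM TD Sp IHj.
  apply: supportedM TD _ Th; elim: j {IHj} => [|j IHj].
    by rewrite expr0; apply: supported1.
  by rewrite exprS; apply: supportedM SD Sg' IHj.
have Tgk : supported T (g ^+ k).
  rewrite -[g ^+ k](subKr (p ^+ k)); apply: supportedD => //.
  exact: supportedN (Tdiff k).
have [g0 | gN0] := eqVneq g 0; first by rewrite def_p g0 add0r.
have [_ []] := Sg _ (mlead_supp gN0).
apply: (Trad _ k); rewrite -mleadX //.
by apply/Tgk/mlead_supp/expf_neq0.
Qed.

End MonomialSupport.

(** * The monomials of the toric ring *)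

Section ToricMonomials.
Variables (K : fieldType) (n : nat) (D : simplicial_complex n).
Implicit Types (F : {set 'I_n}) (s : seq {set 'I_n}) (m : 'X_{1..n.+1}).

Definition face_mnm F : 'X_{1..n.+1} :=
  ((\sum_(i in F) U_(lift ord_max i)) + U_(ord_max))%MM.

Lemma face_monomialE F : face_monomial K F = 'X_[face_mnm F].
Proof.
rewrite /face_monomial mpolyXD; congr (_ * _).
by elim/big_rec2: _ => [|i m p _ ->]; rewrite ?mpolyX0 ?mpolyXD.
Qed.

Lemma face_mnm_lift F i : face_mnm F (lift ord_max i) = (i \in F).
Proof.
rewrite mnmDE mnm1E (negbTE (neq_lift _ _)) addn0 mnm_sumE.
rewrite (eq_bigr (fun j => (j == i) : nat)) => [|j _]; last first.
  by rewrite mnm1E (inj_eq lift_inj).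
have [iF | iF] := boolP (i \in F).
  by rewrite (bigD1 i) //= eqxx big1 ?addn0 // => j /andP[_ /negbTE->].
by rewrite big1 // => j jF; case: eqP => // ji; rewrite -ji jF in iF.
Qed.

Lemma face_mnm_max F : face_mnm F ord_max = 1%N.
Proof.
rewrite mnmDE mnm1E eqxx mnm_sumE big1 // => i _.
by rewrite mnm1E eq_sym (negbTE (neq_lift _ _)).
Qed.

Definition toric_mnm m :=
  exists2 s, {subset s <= faces D} & m = (\sum_(F <- s) face_mnm F)%MM.

Lemma toric_mnm0 : toric_mnm 0%MM.
Proof. by exists [::]; rewrite ?big_nil. Qed.

Lemma toric_mnmD m1 m2 : toric_mnm m1 -> toric_mnm m2 -> toric_mnm (m1 + m2)%MM.
Proof.
move=> [s1 s1D ->] [s2 s2D ->]; exists (s1 ++ s2); last by rewrite big_cat.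
by move=> F; rewrite mem_cat => /orP[/s1D | /s2D].
Qed.

Lemma face_toric_mnm F : F \in faces D -> toric_mnm (face_mnm F).
Proof.
by move=> FD; exists [:: F]; rewrite ?big_seq1 // => G; rewrite inE => /eqP->.
Qed.

(** Translates factorizations into generators into face covers, the language
    of the duality. *)
Lemma toric_mnmP m :
  toric_mnm m <->
  exists s, [/\ {subset s <= faces D}, size s = m ord_max
    & forall i, multiplicity s i = m (lift ord_max i)].
Proof.
have sum_lift s i :
    (\sum_(F <- s) face_mnm F)%MM (lift ord_max i) = multiplicity s i.
  rewrite mnm_sumE /multiplicity -sumn_count sumnE big_map.
  by apply: eq_bigr => F _; rewrite face_mnm_lift.
have sum_max s : (\sum_(F <- s) face_mnm F)%MM ord_max = size s.
  by rewrite mnm_sumE (eq_bigr _ (fun F _ => face_mnm_max F)) sum1_size.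
split=> [[s sD ->] | [s [sD szs ms]]]; exists s => //.
  by split=> [//||i]; rewrite ?sum_max ?sum_lift.
apply/mnmP => j; case: (unliftP ord_max j) => [i ->|->].
  by rewrite sum_lift.
by rewrite sum_max.
Qed.

(** Polynomials supported on toric monomials form a subalgebra containing the
    generators, and each toric monomial is a product of generators. *)
Lemma mem_toric_ring (p : {mpoly K[n.+1]}) :
  p \in subalg_gen (toric_generators D) <-> supported toric_mnm p.
Proof.
split=> [/asboolP gen_p | supp_p].
  suff: p \in [pred q | `[< supported toric_mnm q >]] by move/asboolP.
  apply: gen_p; last first.
    move=> _ /existsP[F /andP[FD /eqP->]]; apply/asboolP.
    by rewrite face_monomialE; apply/supportedX; apply: face_toric_mnm.
  split.
  - by apply/asboolP; apply: supported1; apply: toric_mnm0.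
  - move=> c u v /asboolP Su /asboolP Sv; apply/asboolP.
    by apply: supportedD => //; apply: supportedZ.
  move=> u v /asboolP Su /asboolP Sv; apply/asboolP.
  exact: supportedM toric_mnmD Su Sv.
rewrite [p]mpolyE big_seq; apply: rpred_sum => m /supp_p[s sD ->].
apply: rpredZ; elim: s sD => [|F s IHs] sD.
  by rewrite big_nil mpolyX0; apply: rpred1.
rewrite big_cons mpolyXD -face_monomialE; apply: rpredM; last first.
  by apply: IHs => G Gs; apply: sD; rewrite inE Gs orbT.
by apply: toric_generatorP; rewrite sD ?mem_head.
Qed.

(** The exponent of t as a generator of the ring is that of the empty face. *)
Definition t_multiple m :=
  exists2 m', toric_mnm m' & m = (m' + face_mnm set0)%MM.

Lemma toric_t_multiple m1 m2 :
  toric_mnm m1 -> t_multiple m2 -> t_multiple (m1 + m2)%MM.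
Proof.
move=> Sm1 [m Sm ->]; exists (m1 + m)%MM; first exact: toric_mnmD.
by rewrite addmA.
Qed.

(** Conversely, a polynomial supported on multiples of t is t times the
    polynomial obtained by dividing each of its terms by t. *)
Lemma mem_ideal_t (r : toric_ring K D) :
  r \in principal_ideal (toric_gen K (sc_set0 D)) <->
  supported t_multiple (val r).
Proof.
split=> [/asboolP[b ->] | supp_r].
  rewrite rmorphM /= face_monomialE.
  apply: (@supportedM _ _ toric_mnm (fun m => m = face_mnm set0)).
  - by move=> m _ Sm ->; exists m.
  - by apply/mem_toric_ring; apply: (valP b).
  by apply/supportedX.
pose q := \sum_(m <- msupp (val r)) (val r)@_m *: 'X_[(m - face_mnm set0)].
have qR : q \in subalg_gen (toric_generators D).
  apply/mem_toric_ring; apply: supported_sum => m /supp_r[m' Sm' ->] _.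
  by rewrite addmK; apply: supportedZ; apply/supportedX.
apply/asboolP; exists (Sub q qR); apply: val_inj.
rewrite rmorphM /= face_monomialE {1}[val r]mpolyE mulr_suml !big_seq.
apply: eq_bigr => m /supp_r[m' _ ->].
by rewrite -scalerAl -mpolyXD addmK.
Qed.

(** Here the duality is used.  It gives a cover s of the vertex exponents of m
    whose size equals the weight of a stable set W.  If s has fewer than
    m ord_max faces, padding it with empty faces shows that m is a multiple of
    t.  Otherwise, k copies of these exponents weigh k * size s on W, so they
    need at least k * m ord_max faces; but m *+ k being a multiple of t, they
    are covered by k * m ord_max - 1 faces. *)
Lemma t_multiple_radical m k :
  has_simplicial_vertices D -> t_multiple (m *+ k)%MM -> t_multiple m.
Proof.
move=> simplD [m' /toric_mnmP[s' [s'D szs' ms']] def_mk].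
have := clique_cover_duality (fun i => m (lift ord_max i)) simplD.
move=> [s [W [sD stW ms szs]]].
have [lt_szs | le_szs] := ltnP (size s) (m ord_max).
  exists (m - face_mnm set0)%MM; last first.
    apply/esym/submK/mnm_lepP => j; case: (unliftP ord_max j) => [i ->|->].
      by rewrite face_mnm_lift inE.
    by rewrite face_mnm_max; case: (m ord_max) lt_szs.
  apply/toric_mnmP; exists (s ++ nseq (m ord_max - (size s).+1) set0); split.
  - move=> F; rewrite mem_cat mem_nseq => /orP[/sD // | /andP[_ /eqP->]].
    exact: sc_set0.
  - rewrite size_cat size_nseq mnmBE face_mnm_max.
    by case: (m ord_max) lt_szs => // M le_szs; rewrite subSS subn1 subnKC.
  move=> i; rewrite multiplicity_cat ms mnmBE face_mnm_lift inE subn0.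
  by rewrite /multiplicity count_nseq inE mul0n addn0.
have := leq_sum_multiplicity stW s'D.
(* The empty face has no vertex, so s' covers exactly k times the vertex
   exponents of m. *)
have -> : (\sum_(i in W) multiplicity s' i = k * size s)%N.
  rewrite szs big_distrr; apply: eq_bigr => i _; rewrite /= mulnC -mulmnE.
  by rewrite def_mk mnmDE face_mnm_lift inE addn0 ms'.
have := congr1 (fun m : 'X_{1..n.+1} => m ord_max) def_mk.
rewrite mulmnE mnmDE face_mnm_max -szs' => size_s' le_s'.
have := leq_mul (leqnn k) le_szs.
by rewrite mulnC size_s' addn1 => /leq_trans/(_ le_s'); rewrite ltnn.
Qed.

End ToricMonomials.

(** * The theorem *)

Lemma principal_ideal_submod (R : comNzRingType) (a : R) :
  submod_closed (principal_ideal a : {pred R^o}).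
Proof.
split; first by apply/asboolP; exists 0; rewrite mul0r.
move=> c _ _ /asboolP[b1 ->] /asboolP[b2 ->]; apply/asboolP.
by exists (c * b1 + b2); rewrite mulrDl -mulrA.
Qed.

Theorem proposition2p2 (K : fieldType) (n : nat) (D : simplicial_complex n) :
  quasi_forest D ->
  radical_ideal (principal_ideal (toric_gen K (sc_set0 D))).
Proof.
move/quasi_forest_simplicial => simplD.
split=> [|r k _]; first exact: principal_ideal_submod.
move=> /mem_ideal_t; rewrite rmorphXn => supp_rk; apply/mem_ideal_t.
apply: (monomial_ideal_radical (toric_mnm0 D) _ _ _ _ supp_rk).
- exact: toric_mnmD.
- exact: toric_t_multiple.
- by move=> m j; apply: t_multiple_radical.
by apply/mem_toric_ring; apply: (valP r).
Qed.
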